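(* Let $\Omega\subseteq\mathbb{H}$ be open and let $f:\Omega\to\mathbb{H}$ be a quaternionic function whose partial derivatives $\frac{\partial f}{\partial t},\frac{\partial f}{\partial x},\frac{\partial f}{\partial y},\frac{\partial f}{\partial z}$ exist and are continuous in $\Omega$. Then $f$ is continuously S-derivable (by the left) in $\Omega$ if and only if both of the following hold. (a) At every point of $\Omega\cap\mathbb{R}$: $$\frac{\partial f}{\partial x}=i\,\frac{\partial f}{\partial t},\qquad \frac{\partial f}{\partial y}=j\,\frac{\partial f}{\partial t},\qquad \frac{\partial f}{\partial z}=k\,\frac{\partial f}{\partial t}.$$ (b) At every point $q = t+r\iota$ of $\Omega\setminus\mathbb{R}$ (with $\iota=\iota(q)$): $$\frac{\partial f}{\partial x}=\Big(\frac{i-\iota i\iota}{2}\Big)\frac{\partial f}{\partial t}-\Big(\frac{i+\iota i\iota}{4}\Big)Df,$$ $$\frac{\partial f}{\partial y}=\Big(\frac{j-\iota j\iota}{2}\Big)\frac{\partial f}{\partial t}-\Big(\frac{j+\iota j\iota}{4}\Big)Df,$$ $$\frac{\partial f}{\partial z}=\Big(\frac{k-\iota k\iota}{2}\Big)\frac{\partial f}{\partial t}-\Big(\frac{k+\iota k\iota}{4}\Big)Df,$$ where $Df:=\frac{\partial f}{\partial t}+i\frac{\partial f}{\partial x}+j\frac{\partial f}{\partial y}+k\frac{\partial f}{\partial z}$ is the left Fueter operator.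
   Context: $\mathbb{H}$ denotes the quaternions; write $q=t+xi+yj+zk$ with $t,x,y,z\in\mathbb{R}$. For $q\in\mathbb{H}\setminus\mathbb{R}$ write uniquely $q=t+r\iota$ with $t$ the real part, $r=\sqrt{x^2+y^2+z^2}>0$ and $\iota=\iota(q)=(xi+yj+zk)/r$, so $\iota^2=-1$. For $q\in\mathbb{H}\setminus\mathbb{R}$ and $h\in\mathbb{H}$ set $$h_\parallel:=\frac{h-\iota h\iota}{2},\qquad h_\perp:=\frac{h+\iota h\iota}{2},\qquad \iota=\iota(q).$$ Continuously S-derivable: a continuously real-differentiable function $f:\Omega\to\mathbb{H}$ is continuously S-derivable by the left in $\Omega$ if there exist continuous functions $A:\Omega\cap\mathbb{R}\to\mathbb{H}$ and $B,C:\Omega\setminus\mathbb{R}\to\mathbb{H}$ such that for all $q\in\Omega\cap\mathbb{R}$, $$\lim_{h\to0}h^{-1}\big(f(q+h)-f(q)-hA(q)\big)=0,$$ and for all $q\in\Omega\setminus\mathbb{R}$, $$\lim_{h\to0}h^{-1}\big(f(q+h)-f(q)-h_\parallel B(q)-h_\perp C(q)\big)=0,$$ where $h\in\mathbb{H}\setminus\{0\}$. *)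

(* Defs.v *)
From HB Require Import structures.
From mathcomp Require Import all_boot all_order all_algebra.
From mathcomp Require Import all_classical all_reals all_analysis.
From mathcomp Require Import ring.

Set Implicit Arguments.
Unset Strict Implicit.
Unset Printing Implicit Defensive.

Import Order.TTheory GRing.Theory Num.Theory.
Import numFieldNormedType.Exports.

Local Open Scope classical_set_scope.
Local Open Scope ring_scope.

(* The coordinates of [q] are those of t + x i + y j + z k. The norm inherited
   from row vectors is the sup norm, which is equivalent to the Euclidean one:
   it is only used through the topology and differentiability. *)
Definition quat (R : realType) : Type := 'rV[R]_4.

HB.instance Definition _ (R : realType) :=
  NormedModule.copy (quat R) 'rV[R]_4.

Section Quaternion.
Variable R : realType.
Implicit Types (p q h : quat R) (c : R).

Definition mkquat (t x y z : R) : quat R := \row_(n < 4) [:: t; x; y; z]`_n.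

Definition qt q : R := q 0 0.
Definition qx q : R := q 0 1.
Definition qy q : R := q 0 2.
Definition qz q : R := q 0 3.

Lemma qtE t x y z : qt (mkquat t x y z) = t. Proof. by rewrite /qt mxE. Qed.
Lemma qxE t x y z : qx (mkquat t x y z) = x. Proof. by rewrite /qx mxE. Qed.
Lemma qyE t x y z : qy (mkquat t x y z) = y. Proof. by rewrite /qy mxE. Qed.
Lemma qzE t x y z : qz (mkquat t x y z) = z. Proof. by rewrite /qz mxE. Qed.

Lemma quatP p q :
  qt p = qt q -> qx p = qx q -> qy p = qy q -> qz p = qz q -> p = q.
Proof.
move=> et ex ey ez; apply/rowP => -[[|[|[|[|//]]]] lt_n4].
- by move: et; rewrite /qt; congr (p 0 _ = q 0 _); apply: val_inj.
- by move: ex; rewrite /qx; congr (p 0 _ = q 0 _); apply: val_inj.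
- by move: ey; rewrite /qy; congr (p 0 _ = q 0 _); apply: val_inj.
- by move: ez; rewrite /qz; congr (p 0 _ = q 0 _); apply: val_inj.
Qed.

Lemma qtD p q : qt (p + q) = qt p + qt q. Proof. by rewrite /qt mxE. Qed.
Lemma qxD p q : qx (p + q) = qx p + qx q. Proof. by rewrite /qx mxE. Qed.
Lemma qyD p q : qy (p + q) = qy p + qy q. Proof. by rewrite /qy mxE. Qed.
Lemma qzD p q : qz (p + q) = qz p + qz q. Proof. by rewrite /qz mxE. Qed.

Lemma qtZ c q : qt (c *: q) = c * qt q. Proof. by rewrite /qt mxE. Qed.
Lemma qxZ c q : qx (c *: q) = c * qx q. Proof. by rewrite /qx mxE. Qed.
Lemma qyZ c q : qy (c *: q) = c * qy q. Proof. by rewrite /qy mxE. Qed.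
Lemma qzZ c q : qz (c *: q) = c * qz q. Proof. by rewrite /qz mxE. Qed.

Lemma qt0 : qt 0 = 0. Proof. by rewrite /qt mxE. Qed.
Lemma qx0 : qx 0 = 0. Proof. by rewrite /qx mxE. Qed.
Lemma qy0 : qy 0 = 0. Proof. by rewrite /qy mxE. Qed.
Lemma qz0 : qz 0 = 0. Proof. by rewrite /qz mxE. Qed.

Definition quatE := (qtE, qxE, qyE, qzE, qtD, qxD, qyD, qzD,
  qtZ, qxZ, qyZ, qzZ, qt0, qx0, qy0, qz0).

Definition qone : quat R := mkquat 1 0 0 0.
Definition qi : quat R := mkquat 0 1 0 0.
Definition qj : quat R := mkquat 0 0 1 0.
Definition qk : quat R := mkquat 0 0 0 1.

(* Hamilton's product: i^2 = j^2 = k^2 = ijk = -1. *)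
Definition qmul p q : quat R := mkquat
  (qt p * qt q - qx p * qx q - qy p * qy q - qz p * qz q)
  (qt p * qx q + qx p * qt q + qy p * qz q - qz p * qy q)
  (qt p * qy q - qx p * qz q + qy p * qt q + qz p * qx q)
  (qt p * qz q + qx p * qy q - qy p * qx q + qz p * qt q).

Fact qmulA : associative qmul.
Proof. by move=> p q h; apply: quatP; rewrite !quatE; ring. Qed.

Fact qmul1q : left_id qone qmul.
Proof. by move=> q; apply: quatP; rewrite !quatE; ring. Qed.

Fact qmulq1 : right_id qone qmul.
Proof. by move=> q; apply: quatP; rewrite !quatE; ring. Qed.

Fact qmulDl : left_distributive qmul +%R.
Proof. by move=> p q h; apply: quatP; rewrite !quatE; ring. Qed.

Fact qmulDr : right_distributive qmul +%R.
Proof. by move=> p q h; apply: quatP; rewrite !quatE; ring. Qed.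

Fact qone_neq0 : qone != 0.
Proof.
apply/eqP => /(congr1 qt); rewrite !quatE => /eqP.
by rewrite oner_eq0.
Qed.

HB.instance Definition _ := GRing.Zmodule_isNzRing.Build (quat R)
  qmulA qmul1q qmulq1 qmulDl qmulDr qone_neq0.

Lemma quat1E : 1 = qone. Proof. by []. Qed.
Lemma quatME p q : p * q = qmul p q. Proof. by []. Qed.

Fact qscaleAl c p q : c *: (p * q) = (c *: p) * q.
Proof. by apply: quatP; rewrite !quatME !quatE; ring. Qed.

HB.instance Definition _ :=
  GRing.Lmodule_isLalgebra.Build R (quat R) qscaleAl.

Fact qscaleAr c p q : c *: (p * q) = p * (c *: q).
Proof. by apply: quatP; rewrite !quatME !quatE; ring. Qed.

HB.instance Definition _ :=
  GRing.Lalgebra_isAlgebra.Build R (quat R) qscaleAr.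

Definition qconj q : quat R := mkquat (qt q) (- qx q) (- qy q) (- qz q).
Definition qsqnorm q : R := qt q ^+ 2 + qx q ^+ 2 + qy q ^+ 2 + qz q ^+ 2.
Definition qinv q : quat R := (qsqnorm q)^-1 *: qconj q.

Fact qsqnorm_eq0 q : (qsqnorm q == 0) = (q == 0).
Proof.
apply/eqP/eqP => [|->]; last by rewrite /qsqnorm !quatE; ring.
move/eqP; rewrite /qsqnorm !paddr_eq0 ?addr_ge0 ?sqr_ge0 // !sqrf_eq0.
by move=> /andP[/andP[/andP[/eqP ? /eqP ?] /eqP ?] /eqP ?];
  apply: quatP; rewrite !quatE.
Qed.

Fact qmulVq : {in [pred q | q != 0], left_inverse 1 qinv *%R}.
Proof.
move=> q; rewrite inE -qsqnorm_eq0 => q0.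
rewrite /qinv -scalerAl; apply: (canLR (scalerK q0)).
by apply: quatP; rewrite quat1E quatME !quatE /qsqnorm; ring.
Qed.

Fact qmulqV : {in [pred q | q != 0], right_inverse 1 qinv *%R}.
Proof.
move=> q; rewrite inE -qsqnorm_eq0 => q0.
rewrite /qinv -scalerAr; apply: (canLR (scalerK q0)).
by apply: quatP; rewrite quat1E quatME !quatE /qsqnorm; ring.
Qed.

Fact qunitP p q : q * p = 1 /\ p * q = 1 -> p != 0.
Proof.
move=> [qp1 _]; apply/eqP => p0.
by move/eqP: qp1; rewrite p0 mulr0 eq_sym oner_eq0.
Qed.

Fact qinv_out : {in [predC [pred q | q != 0]], qinv =1 id}.
Proof.
move=> q; rewrite inE negbK => /eqP ->.
by apply: quatP; rewrite !quatE; ring.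
Qed.

HB.instance Definition _ := GRing.NzRing_hasMulInverse.Build (quat R)
  qmulVq qmulqV qunitP qinv_out.

Definition realquat : set (quat R) := range (fun t : R => t%:A).

Definition qradius q : R := Num.sqrt (qx q ^+ 2 + qy q ^+ 2 + qz q ^+ 2).

(* Equal to 0 on the reals, where the imaginary unit is not defined. *)
Definition qiota q : quat R :=
  (qradius q)^-1 *: (qx q *: qi + qy q *: qj + qz q *: qk).

Definition hpar q h : quat R := 2^-1 *: (h - qiota q * h * qiota q).
Definition hperp q h : quat R := 2^-1 *: (h + qiota q * h * qiota q).

(* Functions on a subset [U] are represented by total functions of which only
   the restriction to [U] matters. *)
Definition continuously_differentiable (U : set (quat R))
    (f : quat R -> quat R) : Prop :=
  (forall q, U q -> differentiable f q) /\ {within U, continuous (jacobian f)}.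

Definition continuously_left_Sderivable (U : set (quat R))
    (f : quat R -> quat R) : Prop :=
  continuously_differentiable U f /\
  exists A B C : quat R -> quat R,
    [/\ {within U `&` realquat, continuous A},
        {within U `\` realquat, continuous B},
        {within U `\` realquat, continuous C},
        forall q, (U `&` realquat) q ->
          h^-1 * (f (q + h) - f q - h * A q) @[h --> (0 : quat R)^'] -->
            (0 : quat R)
      & forall q, (U `\` realquat) q ->
          h^-1 * (f (q + h) - f q - hpar q h * B q - hperp q h * C q)
            @[h --> (0 : quat R)^'] --> (0 : quat R)].

Definition left_fueter (f : quat R -> quat R) q : quat R :=
  'D_1 f q + qi * 'D_qi f q + qj * 'D_qj f q + qk * 'D_qk f q.

End Quaternion.

Arguments qi {R}.
Arguments qj {R}.
Arguments qk {R}.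
Arguments realquat {R}.

(* Main.v *)
From HB Require Import structures.
Require Import Defs.
From mathcomp Require Import all_boot all_order all_algebra.
From mathcomp Require Import all_classical all_reals all_analysis.
From mathcomp Require Import ring lra.

Import Order.TTheory GRing.Theory Num.Theory.
Import numFieldNormedType.Exports.

Local Open Scope classical_set_scope.
Local Open Scope ring_scope.

(** Dividing by [h = s e] on the left and letting the real [s] tend to 0 turns
    S-derivability at [q] into the equations [D_e f = e A] (real [q]) and
    [D_e f = e_par B + e_perp C] (other [q]), for [e = 1, i, j, k]. Taking
    [e = 1] gives [A = B = D_1 f]. Since [i v i + j v j + k v k = v] for
    imaginary [v], the sums of [e e_par] and [e e_perp] over [e = i, j, k] are
    [-1] and [-2], so [D f = B - B - 2 C = -2 C], and the equations become (a)
    and (b). Conversely, continuous partial derivatives make [f] Frechet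
    differentiable, (a) and (b) identify ['d f q h] with [h A], respectively
    [h_par B + h_perp C], and [h^-1 * o(h)] tends to 0. *)

(** * Sup norm and convergence of matrices, entry by entry *)

Lemma mx_entry_le_norm {R : realDomainType} m n (M : 'M[R]_(m, n)) i j :
  `|M i j| <= `|M|.
Proof.
by rewrite [leRHS]/Num.Def.normr /= mx_normrE; exact: (le_bigmax _ _ (i, j)).
Qed.

Lemma mx_norm_le {R : realDomainType} m n (M : 'M[R]_(m, n)) e :
  0 <= e -> (forall i j, `|M i j| <= e) -> `|M| <= e.
Proof.
move=> e0 Me; rewrite [leLHS]/Num.Def.normr /= mx_normrE.
by apply: bigmax_le => // -[i j] _; exact: Me.
Qed.

Lemma cvg_mx {X : topologicalType} {T : Type} m n (F : set_system T)
    (FF : Filter F) (M : T -> 'M[X]_(m, n)) (L : 'M[X]_(m, n)) :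
  (forall i j, M x i j @[x --> F] --> L i j) -> M @ F --> L.
Proof.
move=> ML A [P LP PA].
have : \forall x \near F, forall i j, P i j (M x i j).
  by apply: filter_forall => i; apply: filter_forall => j; exact/ML/LP.
by apply: filterS => x Px; exact: PA.
Qed.

(** * Mean value estimate along a line, and remainder criterion for differentiability *)

Lemma is_derive_line {R : realType} {V W : normedModType R} (f : V -> W) p e u :
  derivable f (p + u *: e) e ->
  is_derive u 1 (fun s => f (p + s *: e)) ('D_e f (p + u *: e)).
Proof.
move=> fe.
have E : (fun h : R => h^-1 *: (((fun s => f (p + s *: e)) \o shift u) (h *: 1)
      - f (p + u *: e))) =
    (fun h => h^-1 *: ((f \o shift (p + u *: e)) (h *: e) - f (p + u *: e))).
  apply/funext => h /=; congr (_ *: (f _ - _)).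
  by rewrite [_%:A]mulr1 scalerDl addrCA.
by split; rewrite /derivable/derive E.
Qed.

(** The mean value theorem applies to each entry separately. The intermediate point depends on the
    entry, but the bound [eps] holds on the whole segment, so it passes to the sup norm. *)
Lemma line_remainder_le {R : realType} {V : normedModType R} n
    (f : V -> 'rV[R]_n) (p e : V) (s : R) (m : 'rV[R]_n) (eps : R) :
  (forall u : R, `|u| <= `|s| ->
    derivable f (p + u *: e) e /\ `|'D_e f (p + u *: e) - m| <= eps) ->
  `|f (p + s *: e) - f p - s *: m| <= eps * `|s|.
Proof.
move=> fe.
have eps0 : 0 <= eps by have [_] := fe 0 ltac:(by rewrite normr0); exact: le_trans.
apply: mx_norm_le => [|i j]; first exact: mulr_ge0.
pose phi (u : R) : R := f (p + u *: e) i j.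
pose dphi (u : R) : R := ('D_e f (p + u *: e)) i j.
have dP (u : R) : `|u| <= `|s| -> is_derive u 1 phi (dphi u).
  move=> /fe [dfu _]; have [dl vl] := is_derive_line f p e u dfu.
  split; first by move/derivable_mxP : dl => /(_ i j).
  by rewrite /dphi -vl (derive_mx dl) mxE.
have cP (u : R) : `|u| <= `|s| -> {for u, continuous phi}.
  by move=> /dP [du _]; apply: differentiable_continuous; apply/derivable1_diffP.
(* The form [dphi c * s] covers both signs of [s]: the theorem is applied on [[0, s]] or on
   [[s, 0]]. *)
have [c cs phiE] : exists2 c, `|c| <= `|s| & phi s - phi 0 = dphi c * s.
  have [s0|/ltW s0] := leP 0 s.
    have b u : u \in `[0, s]%R -> `|u| <= `|s|.
      by rewrite in_itv /= => /andP[u0 us]; rewrite !ger0_norm.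
    have [||c cI E] := @MVT_segment R phi dphi 0 s s0.
    - move=> x xI; apply/dP/b; exact: subset_itv_oo_cc.
    - by apply: continuous_in_subspaceT => x /set_mem xI; apply/cP/b.
    by exists c; [exact: b|rewrite E subr0].
  have b u : u \in `[s, 0]%R -> `|u| <= `|s|.
    by rewrite in_itv /= => /andP[us u0]; rewrite !ler0_norm// lerN2.
  have [||c cI E] := @MVT_segment R phi dphi s 0 s0.
  - move=> x xI; apply/dP/b; exact: subset_itv_oo_cc.
  - by apply: continuous_in_subspaceT => x /set_mem xI; apply/cP/b.
  by exists c; [exact: b|rewrite -opprB E sub0r mulrN opprK].
have -> : (f (p + s *: e) - f p - s *: m) i j
    = ('D_e f (p + c *: e) - m) i j * s.
  rewrite !mxE mulrBl -/(dphi c) -phiE /phi scale0r addr0.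
  by rewrite [m i j * s]mulrC.
rewrite normrM ler_wpM2r//; apply: le_trans (mx_entry_le_norm _ _ _ _ _) _.
by have [] := fe _ cs.
Qed.

(** The bound is a first-order expansion with [L]. Uniqueness of the differential then identifies
    ['d f q] with [L], which turns it into the expansion that differentiability asks for. *)
Lemma differentiable_near_le {K : numFieldType} {V W : normedModType K}
    (f : V -> W) (L : V -> W) q :
  linear L -> continuous L ->
  (forall eps, 0 < eps -> \forall h \near (0 : V),
    `|f (h + q) - f q - L h| <= eps * `|h|) ->
  differentiable f q.
Proof.
move=> Llin Lc fL.
pose L' : {linear V -> W} := HB.pack L (GRing.isLinear.Build _ _ _ _ _ Llin).
have fo : f \o shift q = cst (f q) + L' +o_ 0 id.
  apply/eqaddoP => eps eps0; apply: filterS (fL _ eps0) => h.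
  by rewrite /= opprD addrA.
by apply/diff_locallyP; rewrite (@diff_unique _ _ _ _ L' _ Lc fo).
Qed.

(** * Continuous partial derivatives imply Frechet differentiability *)

Section continuous_partials.
Context {R : realType} {n m : nat} (f : 'rV[R]_n -> 'rV[R]_m) (q : 'rV[R]_n).
Let e_ (i : 'I_n) : 'rV[R]_n := delta_mx 0 i.
Hypothesis fe : forall i, \forall x \near q, derivable f x (e_ i).
Hypothesis Dfe : forall i, {for q, continuous ('D_(e_ i) f)}.

Let df (h : 'rV[R]_n) : 'rV[R]_m := \sum_i h 0 i *: 'D_(e_ i) f q.

Let df_is_linear : linear df.
Proof.
move=> a u v; rewrite /df scaler_sumr -big_split /=; apply: eq_bigr => i _.
by rewrite !mxE scalerDl scalerA.
Qed.

Let df_continuous : continuous df.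
Proof.
rewrite /= /df; apply: continuous_big; first exact: add_continuous.
move=> i _ x; apply: cvgZr_tmp; [exact: nbhs_filter x|exact: coord_continuous].
Qed.

(* The path from [q] to [q + h] along the axes visits the points
   [q + corner h k]. *)
Let corner (h : 'rV[R]_n) k : 'rV[R]_n := \row_i (h 0 i *+ (i < k)).

Let cornerS h (k : 'I_n) : corner h k.+1 = corner h k + h 0 k *: e_ k.
Proof.
apply/rowP => i; rewrite !mxE eqxx /= ltnS.
have [->|ik] := eqVneq i k; first by rewrite leqnn ltnn add0r mulr1.
by rewrite mulr0 addr0 ltn_neqAle ik.
Qed.

(** Each coordinate of this point is 0, [u] or a coordinate of [h]. Hence the path stays in any ball
    around [q] that is known to contain [q + h]. *)
Let corner_dist (h : 'rV[R]_n) (k : 'I_n) (u : R) : `|u| <= `|h 0 k| ->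
  `|corner h k + u *: e_ k| <= `|h|.
Proof.
move=> uh; apply: mx_norm_le => // i j; rewrite ord1 !mxE eqxx /=.
have [->|jk] := eqVneq j k.
  rewrite ltnn add0r mulr1; apply: le_trans uh _; exact: mx_entry_le_norm.
rewrite mulr0 addr0; case: (_ < _)%N; last by rewrite normr0.
exact: mx_entry_le_norm.
Qed.

Lemma continuous_partials_differentiable : differentiable f q.
Proof.
apply: (@differentiable_near_le R _ _ f df) => [||eps eps0].
- exact: df_is_linear.
- exact: df_continuous.
(* Each of the [n] edges of the path costs [eps' * |h|]; dividing by [n.+1] avoids a zero
   denominator when [n = 0]. *)
pose eps' := eps / n.+1%:R.
have eps'0 : 0 < eps' by rewrite divr_gt0.
have /nbhs_ballP [d /= d0 dP] : \forall x \near (q : 'rV[R]_n),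
    forall i, derivable f x (e_ i) /\ `|'D_(e_ i) f x - 'D_(e_ i) f q| <= eps'.
  apply: (@filter_forall _ _ _ _ (nbhs_filter q)) => i.
  apply: (@filterI _ _ (nbhs_filter q)); first exact: fe.
  have /cvgrPdist_le/(_ _ eps'0) := Dfe i.
  by apply: (@filterS _ _ (nbhs_filter q)) => x dx; rewrite distrC; exact: dx.
near=> h.
have hd : `|h| < d by near: h; exact: (@pseudometric_normed_Zmodule.nbhs0_lt R 'rV[R]_n).
(* The increments along the edges telescope, because [corner h n = h] and [corner h 0 = 0]. *)
have -> : f (h + q) - f q - df h =
    \sum_(k < n) (f (q + corner h k + h 0 k *: e_ k) - f (q + corner h k)
       - h 0 k *: 'D_(e_ k) f q).
  rewrite sumrB -/(df h); congr (_ - _).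
  under eq_bigr do rewrite -addrA -cornerS.
  rewrite -(big_mkord xpredT (fun k => f (q + corner h k.+1) - f (q + corner h k))).
  rewrite telescope_sumr//; congr (f _ - f _).
    by rewrite addrC; congr +%R; apply/rowP => i; rewrite !mxE ltn_ord.
  by rewrite -[LHS]addr0; congr +%R; apply/rowP => i; rewrite !mxE.
apply: le_trans (ler_norm_sum _ _ _) _.
apply: (@le_trans _ _ (\sum_(k < n) eps' * `|h|)).
  apply: ler_sum => k _.
  apply: le_trans (line_remainder_le m f _ _ _ _ eps' _) _; last first.
    by rewrite ler_pM2l//; exact: mx_entry_le_norm.
  move=> u uh; apply: dP; rewrite -ball_normE /= -addrA opprD addNKr normrN.
  apply: le_lt_trans hd; exact: corner_dist.
rewrite sumr_const card_ord -mulrnAl ler_wpM2r// /eps' -mulr_natr -mulrA ler_piMr ?ltW//.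
by rewrite ltr_pdivrMl// mulr1 ltr_nat.
Unshelve. all: by end_near. Qed.

End continuous_partials.

(** * Norm estimates for quaternion products and inverses *)

Section QuaternionFacts.
Context {R : realType}.
Implicit Types (p q h : quat R) (f : quat R -> quat R).

Lemma quat_coord_le q : [/\ `|qt q| <= `|q|, `|qx q| <= `|q|,
  `|qy q| <= `|q| & `|qz q| <= `|q|].
Proof. by split; exact: mx_entry_le_norm. Qed.

Lemma quat_norm_le q (e : R) : `|qt q| <= e -> `|qx q| <= e ->
  `|qy q| <= e -> `|qz q| <= e -> `|q| <= e.
Proof.
move=> te xe ye ze; apply: mx_norm_le => [|i j].
  exact: le_trans te.
rewrite ord1; case: j => -[|[|[|[|//]]]] lt_n4.
- by rewrite (_ : Ordinal _ = 0)//; exact: val_inj.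
- by rewrite (_ : Ordinal _ = 1)//; exact: val_inj.
- by rewrite (_ : Ordinal _ = 2)//; exact: val_inj.
- by rewrite (_ : Ordinal _ = 3)//; exact: val_inj.
Qed.

(** The sup norm is not multiplicative: each coordinate of the product is a signed sum of four
    products of coordinates, whence the factor 4. *)
Lemma quat_normM_le p q : `|p * q| <= 4 * (`|p| * `|q|).
Proof.
have [pt px py pz] := quat_coord_le p; have [t x y z] := quat_coord_le q.
have M (a b : R) : `|a| <= `|p| -> `|b| <= `|q| -> `|a * b| <= `|p| * `|q|.
  by move=> ap bq; rewrite normrM ler_pM.
have S (a b c d e : R) : `|a| <= e -> `|b| <= e -> `|c| <= e -> `|d| <= e ->
    [/\ `|a - b - c - d| <= 4 * e, `|a + b + c - d| <= 4 * e,
      `|a - b + c + d| <= 4 * e & `|a + b - c + d| <= 4 * e].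
  by rewrite !ler_norml => /andP[? ?] /andP[? ?] /andP[? ?] /andP[? ?];
    split; apply/andP; split; lra.
rewrite quatME; apply: quat_norm_le; rewrite !quatE.
- by have [] := S _ _ _ _ _ (M _ _ pt t) (M _ _ px x) (M _ _ py y) (M _ _ pz z).
- by have [] := S _ _ _ _ _ (M _ _ pt x) (M _ _ px t) (M _ _ py z) (M _ _ pz y).
- by have [] := S _ _ _ _ _ (M _ _ pt y) (M _ _ px z) (M _ _ py t) (M _ _ pz x).
- by have [] := S _ _ _ _ _ (M _ _ pt z) (M _ _ px y) (M _ _ py x) (M _ _ pz t).
Qed.

Lemma quat_sqr_norm_le q : `|q| ^+ 2 <= qsqnorm q.
Proof.
rewrite -[leRHS]sqr_sqrtr ?addr_ge0 ?sqr_ge0//.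
rewrite ler_sqr ?nnegrE ?sqrtr_ge0//.
by apply: quat_norm_le; rewrite -sqrtr_sqr ler_wsqrtr// /qsqnorm;
  have := sqr_ge0 (qt q); have := sqr_ge0 (qx q);
  have := sqr_ge0 (qy q); have := sqr_ge0 (qz q); lra.
Qed.

(** The inverse is the conjugate, which has the same sup norm as [h], divided by the squared
    Euclidean norm, which is at least [|h| ^+ 2]. At [h = 0] both inverses are 0 by convention. *)
Lemma quat_normV_le h : `|h^-1| <= `|h|^-1.
Proof.
have [->|h0] := eqVneq h 0; first by rewrite invr0 normr0 invr0.
have nh : 0 < `|h| by rewrite normr_gt0.
have sh : 0 < qsqnorm h.
  by apply: lt_le_trans (quat_sqr_norm_le h); rewrite exprn_gt0.
have [t x y z] := quat_coord_le h.
rewrite [h^-1]/(qinv h) normrZ gtr0_norm ?invr_gt0//.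
apply: (@le_trans _ _ ((qsqnorm h)^-1 * `|h|)).
  apply: ler_wpM2l; first by rewrite invr_ge0 ltW.
  by apply: quat_norm_le; rewrite !quatE ?normrN.
rewrite ler_pdivrMl// ler_pdivlMr// -expr2; exact: quat_sqr_norm_le.
Qed.

(** * Limits of quotients by left division *)

Lemma cvg_quat_mull {T : Type} (F : set_system T) {FF : Filter F}
    (c : quat R) (g : T -> quat R) (l : quat R) :
  g @ F --> l -> (fun x => c * g x) @ F --> c * l.
Proof.
move=> /cvgrPdist_le gl; apply/cvgrPdist_le => e e0.
(* The [+ 1] keeps the divisor positive when [c = 0]. *)
have c0 : 0 < 4 * (`|c| + 1) by rewrite mulr_gt0 ?ltr_wpDl.
apply: filterS (gl (e / (4 * (`|c| + 1))) _) => [x gx|]; last exact: divr_gt0.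
rewrite -mulrBr; apply: le_trans (quat_normM_le _ _) _.
move: gx; rewrite ler_pdivlMr// => /(le_trans _); apply.
by have := normr_ge0 (l - g x); nra.
Qed.

(** Restrict the limit to [h = s *: e] with [s] real and multiply on the left by [e]. Since [s] is
    central, [e * (s *: e)^-1 = s^-1], which leaves the real difference quotient minus [L e]. *)
Lemma derive_of_left_limit f (L : quat R -> quat R) q e :
  e != 0 -> linear L ->
  h^-1 * (f (q + h) - f q - L h) @[h --> (0 : quat R)^'] --> (0 : quat R) ->
  'D_e f q = L e.
Proof.
move=> e0 Llin fL; apply: cvg_lim => //.
pose L' : {linear quat R -> quat R} :=
  HB.pack L (GRing.isLinear.Build _ _ _ _ _ Llin).
have Le (s : R) : L (s *: e) = s *: L e by rewrite -[LHS]/(L' _) linearZ.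
(* As [e != 0], the line meets 0 only at [s = 0], so punctured neighbourhoods correspond. *)
have sE : s *: e @[s --> (0 : R)^'] --> (0 : quat R)^'.
  move=> A /= A0.
  have s0 : s *: e @[s --> (0 : R)] --> (0 : quat R).
    by rewrite -[X in _ --> X](scale0r e); apply: cvgZr_tmp; exact: cvg_id.
  apply: (@filterS _ (nbhs (0 : R)) _ _ _ _ (s0 _ A0)) => s As sn0; apply: As.
  by rewrite /= scaler_eq0 negb_or sn0.
have := cvg_quat_mull _ e _ _ (cvg_comp _ _ sE fL).
rewrite mulr0 => eL.
have H : L e + e * ((s *: e)^-1 * (f (q + s *: e) - f q - L (s *: e)))
    @[s --> (0 : R)^'] --> L e.
  by rewrite -[X in _ --> X]addr0; apply: cvgD; [exact: cvg_cst|exact: eL].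
apply: cvg_trans H.
apply: near_eq_cvg; near=> s.
have s0 : s != 0 by near: s; exact: nbhs_dnbhs_neq.
rewrite /= Le [q + _]addrC.
rewrite (_ : (s *: e)^-1 = s^-1 *: e^-1); last first.
  by rewrite invrZ ?unitfE// unitE.
rewrite -scalerAl -scalerAr mulrA divrr ?mul1r//.
by rewrite scalerBr scalerK// [L e + _]addrC subrK.
Unshelve. all: by end_near. Qed.

(** The remainder is [o(h)] and [|h^-1| <= |h|^-1]; taking [eps / 4] absorbs the factor 4 of the
    product estimate. *)
Lemma left_limit_of_differentiable f q :
  differentiable f q ->
  h^-1 * (f (q + h) - f q - 'd f q h) @[h --> (0 : quat R)^'] --> (0 : quat R).
Proof.
move=> /diff_locallyP [_ fo].
apply/cvgrPdist_le => eps eps0.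
have eps4 : 0 < eps / 4 by rewrite divr_gt0.
have /eqaddoP/(_ _ eps4) fe := fo.
have {}fe : \forall h \near (0 : quat R),
    `|f (q + h) - f q - 'd f q h| <= eps / 4 * `|h|.
  by apply: filterS fe => h; rewrite opprD addrA [q + h]addrC.
apply: cvg_within; apply: filterS fe => h fh.
rewrite sub0r normrN; apply: le_trans (quat_normM_le _ _) _.
(* [cvg_within] passed to full neighbourhoods, so [h = 0] has to be covered too; there
   [0^-1 = 0]. *)
have [->|h0] := eqVneq h 0; first by rewrite invr0 normr0 mul0r mulr0 ltW.
rewrite -ler_pdivlMl// [4^-1 * _]mulrC.
apply: le_trans (ler_pM _ _ (quat_normV_le h) fh) _ => //.
by rewrite mulrCA mulVf ?mulr1// normr_eq0.
Qed.

End QuaternionFacts.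

(** * Partial derivatives in the basis 1, i, j, k *)

Section Sderivable.
Context {R : realType}.
Implicit Types (p q h : quat R) (f : quat R -> quat R) (U : set (quat R)).

Let qtN q : qt (- q) = - qt q. Proof. by rewrite /qt mxE. Qed.
Let qxN q : qx (- q) = - qx q. Proof. by rewrite /qx mxE. Qed.
Let qyN q : qy (- q) = - qy q. Proof. by rewrite /qy mxE. Qed.
Let qzN q : qz (- q) = - qz q. Proof. by rewrite /qz mxE. Qed.

Let coordE := (quat1E, quatME, @quatE R, qtN, qxN, qyN, qzN).

(** Links the canonical basis of row vectors, used for differentials and Jacobians, to the
    quaternion units of the hypotheses. *)
Lemma delta_mx_quat (i : 'I_4) :
  (delta_mx 0 i : quat R) \in [:: 1; qi; qj; qk].
Proof.
case: i => -[|[|[|[|//]]]] lt_n4; rewrite !inE; apply/or4P.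
- by constructor 1; apply/eqP/rowP => -[[|[|[|[|//]]]] ?]; rewrite !mxE.
- by constructor 2; apply/eqP/rowP => -[[|[|[|[|//]]]] ?]; rewrite !mxE.
- by constructor 3; apply/eqP/rowP => -[[|[|[|[|//]]]] ?]; rewrite !mxE.
- by constructor 4; apply/eqP/rowP => -[[|[|[|[|//]]]] ?]; rewrite !mxE.
Qed.

Lemma quat_basis_neq0 (e : quat R) : e \in [:: 1; qi; qj; qk] -> e != 0.
Proof.
rewrite !inE => /or4P[] /eqP ->; first exact: oner_neq0.
- by apply/eqP => /(congr1 (@qx R)); rewrite !quatE => /eqP; rewrite oner_eq0.
- by apply/eqP => /(congr1 (@qy R)); rewrite !quatE => /eqP; rewrite oner_eq0.
- by apply/eqP => /(congr1 (@qz R)); rewrite !quatE => /eqP; rewrite oner_eq0.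
Qed.

Lemma quat_decomp h : h = qt h *: 1 + qx h *: qi + qy h *: qj + qz h *: qk.
Proof. by apply: quatP; rewrite !coordE; ring. Qed.

(** Row [i] of the Jacobian is the derivative along the [i]-th unit, so its entries inherit
    continuity from the partial derivatives. Openness of [U] turns continuity within [U] into
    continuity at each point. *)
Lemma continuous_partials_continuously_differentiable U f :
  open U ->
  (forall e : quat R, e \in [:: 1; qi; qj; qk] ->
    forall q, U q -> derivable f q e) ->
  (forall e : quat R, e \in [:: 1; qi; qj; qk] ->
    {within U, continuous (fun q => 'D_e f q)}) ->
  continuously_differentiable U f.
Proof.
move=> Uo fe Dfe.
have Dc (e : quat R) q : e \in [:: 1; qi; qj; qk] -> U q ->
    {for q, continuous (fun q => 'D_e f q)}.
  by move=> /Dfe; rewrite continuous_open_subspace// => + Uq; apply; exact/mem_set.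
have nU q : U q -> \forall x \near q, U x by move=> Uq; exact: open_nbhs_nbhs.
have df q : U q -> differentiable f q.
  move=> Uq; apply: (@continuous_partials_differentiable R 4 4 f q) => i.
    by apply: filterS (nU _ Uq) => x Ux; apply: fe => //; exact: delta_mx_quat.
  by apply: Dc => //; exact: delta_mx_quat.
split=> //; rewrite continuous_open_subspace// => q /set_mem Uq.
apply: (@cvg_mx R (quat R) 4 4 (nbhs q) (nbhs_filter q)) => i j.
have JE x : U x -> jacobian f x i j = ('D_(delta_mx 0 i : quat R) f x) 0 j.
  move=> Ux; transitivity (((delta_mx 0 i : 'rV[R]_4) *m @jacobian 4 4 R f x) 0 j).
    by rewrite -rowE [RHS]mxE.
  by rewrite -(@deriveEjacobian R 4 4 f x (delta_mx 0 i) (df x Ux)).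
have Dij : ('D_(delta_mx 0 i : quat R) f x) 0 j @[x --> q]
    --> ('D_(delta_mx 0 i : quat R) f q) 0 j.
  apply: (@continuous_comp _ _ _ (fun x => 'D_(delta_mx 0 i : quat R) f x)
    (fun v : 'rV[R]_4 => v 0 j)); last exact: coord_continuous.
  by apply: Dc => //; exact: delta_mx_quat.
rewrite -(JE q Uq) in Dij.
(* [JE] is known on [U] only, but [U] is a neighbourhood of [q]. *)
apply: cvg_trans Dij; apply: near_eq_cvg.
by apply: (@filterS _ _ (nbhs_filter q) _ _ _ (nU _ Uq)) => x /JE.
Qed.

Lemma diff_eq_on_basis f q (L : quat R -> quat R) :
  differentiable f q -> linear L ->
  (forall e : quat R, e \in [:: 1; qi; qj; qk] -> 'D_e f q = L e) ->
  'd f q =1 L.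
Proof.
move=> df Llin fL h.
pose L' : {linear quat R -> quat R} :=
  HB.pack L (GRing.isLinear.Build _ _ _ _ _ Llin).
rewrite -[L h]/(L' h) (quat_decomp h) !linearD !linearZ /=.
by rewrite -!fL ?inE ?eqxx ?orbT// !deriveE.
Qed.

(** * Algebra of the components parallel and perpendicular to the imaginary unit *)

Lemma qiota_sqr q : ~ realquat q -> qiota q * qiota q = -1.
Proof.
move=> nq.
have s0 : 0 <= qx q ^+ 2 + qy q ^+ 2 + qz q ^+ 2 by rewrite !addr_ge0 ?sqr_ge0.
have r0 : qradius q != 0.
  apply/eqP => /eqP; rewrite sqrtr_eq0 le_eqVlt ltNge s0 orbF.
  rewrite !paddr_eq0 ?addr_ge0 ?sqr_ge0// !sqrf_eq0.
  move=> /andP[/andP[/eqP x0 /eqP y0] /eqP z0]; apply: nq.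
  by exists (qt q) => //; apply: quatP; rewrite !coordE ?x0 ?y0 ?z0; ring.
rewrite /qiota -scalerAl -scalerAr scalerA -invfM -expr2.
apply: (canLR (scalerK _)); first by rewrite sqrf_eq0.
by rewrite sqr_sqrtr//; apply: quatP; rewrite !coordE; ring.
Qed.

Lemma qt_qiota q : qt (qiota q) = 0.
Proof. by rewrite /qiota !coordE; ring. Qed.

Lemma hpar_linear q : linear (hpar q).
Proof.
move=> a u v; rewrite /hpar; move: (qiota q) => I.
rewrite mulrDr mulrDl opprD addrACA scalerDr -scalerAr -scalerAl -scalerBr.
by rewrite !scalerA [2^-1 * a]mulrC.
Qed.

Lemma hperp_linear q : linear (hperp q).
Proof.
move=> a u v; rewrite /hperp; move: (qiota q) => I.
rewrite mulrDr mulrDl addrACA -scalerAr -scalerAl -scalerDr [LHS]scalerDr.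
by rewrite !scalerA [2^-1 * a]mulrC.
Qed.

Lemma hpar_hperp_linear q (B C : quat R) :
  linear (fun h => hpar q h * B + hperp q h * C).
Proof.
move=> a u v; rewrite hpar_linear hperp_linear.
move: (hpar q u) (hpar q v) (hperp q u) (hperp q v) => x y z w.
by rewrite !mulrDl -!scalerAl scalerDr addrACA.
Qed.

(** 1 commutes with [qiota q], so it is purely parallel. At a real [q], where [qiota q = 0], the
    value would be one half. *)
Lemma hpar1 q : ~ realquat q -> hpar q 1 = 1.
Proof.
move=> nq; rewrite /hpar mulr1 qiota_sqr// opprK.
by apply: quatP; rewrite !coordE; field.
Qed.

Lemma hperp1 q : ~ realquat q -> hperp q 1 = 0.
Proof. by move=> nq; rewrite /hperp mulr1 qiota_sqr// subrr scaler0. Qed.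

(** For [v = i] the three terms are [-i], [i], [i]; the cases [j] and [k] are symmetric. *)
Lemma imag_basis_conj_sum (v : quat R) : qt v = 0 ->
  qi * v * qi + qj * v * qj + qk * v * qk = v.
Proof. by move=> v0; apply: quatP; rewrite !coordE v0; ring. Qed.

Lemma imag_basis_sqr_sum :
  qi * qi + qj * qj + qk * qk = (-3) *: 1 :> quat R.
Proof. by apply: quatP; rewrite !coordE; ring. Qed.

(** Pulls a common right factor, the imaginary unit up to sign, out of the next two sums, so that
    the squares and the conjugation sum separate. *)
Lemma sum3_mulDl {S : pzRingType} (a b c x y z v : S) :
  (a + x * v) + (b + y * v) + (c + z * v) = (a + b + c) + (x + y + z) * v.
Proof. by rewrite !mulrDl (AC ((2*2)*2) ((1*3*5)*(2*4*6))). Qed.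

(** With [I = qiota q] the sum is half of [-3 - I * I], that is of [-3 + 1]. *)
Lemma imag_basis_hpar_sum q : ~ realquat q ->
  qi * hpar q qi + qj * hpar q qj + qk * hpar q qk = -1.
Proof.
move=> nq; have := qt_qiota q; have := qiota_sqr _ nq; rewrite /hpar.
move: (qiota q) => I I2 I0; rewrite -!scalerAr -!scalerDr !mulrBr !mulrA.
rewrite -!mulrN sum3_mulDl imag_basis_sqr_sum imag_basis_conj_sum// mulrN I2.
by apply: quatP; rewrite !coordE; field.
Qed.

(** Here the sum is half of [-3 + I * I], that is of [-3 - 1]. *)
Lemma imag_basis_hperp_sum q : ~ realquat q ->
  qi * hperp q qi + qj * hperp q qj + qk * hperp q qk = (-2) *: 1.
Proof.
move=> nq; have := qt_qiota q; have := qiota_sqr _ nq; rewrite /hperp.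
move: (qiota q) => I I2 I0; rewrite -!scalerAr -!scalerDr !mulrDr !mulrA.
rewrite sum3_mulDl imag_basis_sqr_sum imag_basis_conj_sum// I2.
by apply: quatP; rewrite !coordE; field.
Qed.

Lemma left_fueterE f q B C : ~ realquat q ->
  (forall e : quat R, e \in [:: 1; qi; qj; qk] ->
    'D_e f q = hpar q e * B + hperp q e * C) ->
  left_fueter f q = (-2) *: C.
Proof.
move=> nq De; rewrite /left_fueter !De ?inE ?eqxx ?orbT//.
have regroup (x1 x2 x3 y1 y2 y3 : quat R) :
    B + qi * (x1 * B + y1 * C) + qj * (x2 * B + y2 * C)
      + qk * (x3 * B + y3 * C)
    = B + (qi * x1 + qj * x2 + qk * x3) * B
      + (qi * y1 + qj * y2 + qk * y3) * C.
  rewrite !mulrDr !mulrDl !mulrA.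
  by rewrite (AC (((1*2)*2)*2) ((1*(2*4*6))*(3*5*7))).
rewrite hpar1// hperp1// mul1r mul0r addr0 regroup.
rewrite imag_basis_hpar_sum// imag_basis_hperp_sum// mulN1r subrr add0r.
by rewrite -scalerAl mul1r.
Qed.

End Sderivable.

(** * The equivalence *)

Theorem theorem1 (R : realType) (Omega : set (quat R))
    (f : quat R -> quat R)
    (open_Omega : open Omega)
    (partials_exist : forall e : quat R, e \in [:: 1; qi; qj; qk] ->
       forall q, Omega q -> derivable f q e)
    (partials_continuous : forall e : quat R, e \in [:: 1; qi; qj; qk] ->
       {within Omega, continuous (fun q => 'D_e f q)}) :
  continuously_left_Sderivable Omega f <->
  (forall q, (Omega `&` realquat) q ->
     [/\ 'D_qi f q = qi * 'D_1 f q,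
         'D_qj f q = qj * 'D_1 f q
       & 'D_qk f q = qk * 'D_1 f q]) /\
  (forall q, (Omega `\` realquat) q ->
     [/\ 'D_qi f q =
           2^-1 *: (qi - qiota q * qi * qiota q) * 'D_1 f q
           - 4^-1 *: (qi + qiota q * qi * qiota q) * left_fueter f q,
         'D_qj f q =
           2^-1 *: (qj - qiota q * qj * qiota q) * 'D_1 f q
           - 4^-1 *: (qj + qiota q * qj * qiota q) * left_fueter f q
       & 'D_qk f q =
           2^-1 *: (qk - qiota q * qk * qiota q) * 'D_1 f q
           - 4^-1 *: (qk + qiota q * qk * qiota q) * left_fueter f q]).
Proof.
split=> [[_ [A [B [C [_ _ _ fA fBC]]]]]|[freal fnreal]]; split.
- move=> q qR.
  have DA e : e \in [:: 1; qi; qj; qk] -> 'D_e f q = e * A q.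
    move=> /quat_basis_neq0 e0.
    apply: (derive_of_left_limit f (fun h => h * A q) q e e0) (fA _ qR).
    by move=> a u v; rewrite mulrDl scalerAl.
  by rewrite !DA ?inE ?eqxx ?orbT// mul1r.
- move=> q qnR; have [_ nq] := qnR.
  have DBC e : e \in [:: 1; qi; qj; qk] ->
      'D_e f q = hpar q e * B q + hperp q e * C q.
    move=> /quat_basis_neq0 e0.
    apply: (derive_of_left_limit f _ q e e0 (hpar_hperp_linear q (B q) (C q))).
    by under eq_fun do rewrite opprD addrA; exact: fBC.
  have D1 : 'D_1 f q = B q.
    by rewrite DBC ?inE ?eqxx// hpar1// hperp1// mul1r mul0r addr0.
  (* By [left_fueterE] the coefficient is [- 4^-1 * (-2) = 2^-1], so the last term in (b) is
     [hperp q e * C q] unfolded. *)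
  have half (v : quat R) : - ((4^-1 *: v) * left_fueter f q) = (2^-1 *: v) * C q.
    rewrite (left_fueterE _ _ _ _ nq DBC) -!scalerAl -scalerAr scalerA -scaleNr.
    by congr (_ *: _); field.
  by rewrite !half D1; split; apply: DBC; rewrite !inE eqxx ?orbT.
- exact: continuous_partials_continuously_differentiable.
have df q : Omega q -> differentiable f q.
  move: q.
  by have [] := continuous_partials_continuously_differentiable _ _ open_Omega
    partials_exist partials_continuous.
have Dc e : e \in [:: 1; qi; qj; qk] ->
    {within Omega `\` realquat, continuous (fun q => 'D_e f q)}.
  by move=> /partials_continuous; apply: continuous_subspaceW; exact: subDsetl.
(* The forward direction forces these witnesses: [A = B = 'D_1 f], and [C] is obtained by solving
   [left_fueter f q = (-2) *: C]. *)
exists (fun q => 'D_1 f q), (fun q => 'D_1 f q),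
  (fun q => - 2^-1 *: left_fueter f q); split.
- apply: continuous_subspaceW (partials_continuous 1 _).
    exact: subIsetl.
  by rewrite !inE eqxx.
- by apply: Dc; rewrite !inE eqxx.
- move=> x; apply: cvgZl_tmp; rewrite /left_fueter.
  by do ![apply: cvgD; last by apply: cvg_quat_mull; apply: Dc;
    rewrite !inE eqxx ?orbT]; apply: Dc; rewrite !inE eqxx.
- move=> q qR; have [Oq _] := qR; have [Dx Dy Dz] := freal _ qR.
  have dE : 'd f q =1 (fun h => h * 'D_1 f q).
    apply: diff_eq_on_basis => [|a u v|e]; first exact: df.
      by rewrite mulrDl scalerAl.
    by rewrite !inE => /or4P[] /eqP ->; rewrite // mul1r.
  by under eq_fun do rewrite -dE; exact/left_limit_of_differentiable/df.
- move=> q qnR; have [Oq nq] := qnR; have [Dx Dy Dz] := fnreal _ qnR.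
  set C := - 2^-1 *: left_fueter f q.
  have half (v : quat R) : - ((4^-1 *: v) * left_fueter f q) = (2^-1 *: v) * C.
    rewrite /C -!scalerAl -scalerAr scalerA -scaleNr.
    by congr (_ *: _); field.
  (* The equations (b) now give the values of [hpar q e * 'D_1 f q + hperp q e * C] at
     [e = i, j, k]; the case [e = 1] follows from [hpar1] and [hperp1]. *)
  rewrite !half in Dx Dy Dz.
  have dE : 'd f q =1 (fun h => hpar q h * 'D_1 f q + hperp q h * C).
    apply: diff_eq_on_basis => [||e]; [exact: df|exact: hpar_hperp_linear|].
    rewrite !inE => /or4P[] /eqP -> //.
    by rewrite hpar1// hperp1// mul1r mul0r addr0.
  under eq_fun do rewrite -addrA -opprD -dE.
  exact/left_limit_of_differentiable/df.
Qed.
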